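(* Every random real computes a perfect weakly-incompressible tree.
   Context: $2^{<\omega}$ is the set of finite binary strings, $2^n$ the set of $n$-bit strings; reals are infinite binary sequences. $K$ is prefix-free Kolmogorov complexity. ''Random'' means Martin-Löf random. A tree is a nonempty set $T\subseteq 2^{<\omega}$ that is downward-closed under the prefix relation $\preceq$. $T$ is perfect if each string in $T$ has at least two $\preceq$-incomparable strict extensions in $T$ (so $T$ is pruned, i.e. has no $\preceq$-maximal elements, and has unbounded width $|T\cap 2^n|$). For a set $E$ of strings let $\mathsf{d}(E)=\sup_{\sigma\in E}(|\sigma|-K(\sigma))$. $T$ is weakly-incompressible if $\liminf_n \mathsf{d}(T\cap 2^n)<\infty$. ''$z$ computes $T$'' means $T\leq_T z$. *)

(* Defs.v *)
From Stdlib Require Cantor.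
From mathcomp Require Import all_boot all_order all_algebra.
From mathcomp Require Import all_classical all_reals all_analysis.

Set Implicit Arguments.
Unset Strict Implicit.
Unset Printing Implicit Defensive.

Import Order.TTheory GRing.Theory Num.Theory.

Local Open Scope classical_set_scope.

Notation cpair x y := (Cantor.to_nat (x, y)).

Inductive program : Type :=
| Zero | Succ | Fst | Snd
| Oracle
| Pair of program & program
| Comp of program & program
| Rec of program & program
| Mu of program.

(* [runs A c x y]: the program [c] with oracle [A] halts on input [x] with    *)
(* output [y].  In [runs_mu] the witness [f] only records that [c] halts with *)
(* a nonzero value on every [cpair x i] with [i < n].                         *)
Inductive runs (A : nat -> bool) : program -> nat -> nat -> Prop :=
| runs_zero x : runs A Zero x 0
| runs_succ x : runs A Succ x x.+1
| runs_fst x y : runs A Fst (cpair x y) x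
| runs_snd x y : runs A Snd (cpair x y) y
| runs_oracle x : runs A Oracle x (A x)
| runs_pair c d x y z :
    runs A c x y -> runs A d x z -> runs A (Pair c d) x (cpair y z)
| runs_comp c d x y z :
    runs A d x y -> runs A c y z -> runs A (Comp c d) x z
| runs_rec0 c d x y :
    runs A c x y -> runs A (Rec c d) (cpair x 0) y
| runs_recS c d x n y w :
    runs A (Rec c d) (cpair x n) y -> runs A d (cpair x (cpair n y)) w ->
    runs A (Rec c d) (cpair x n.+1) w
| runs_mu c x n (f : nat -> nat) :
    runs A c (cpair x n) 0 ->
    (forall i, i < n -> runs A c (cpair x i) (f i).+1) ->
    runs A (Mu c) x n.

(* Unrelativized computation: the oracle is the empty set. *)
Definition computes (c : program) (x y : nat) : Prop := runs (fun=> false) c x y.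

(* Bijective base-2 numeration: a bijection between binary strings and nat. *)
Fixpoint strcode (s : seq bool) : nat :=
  if s is b :: s' then (strcode s').*2 + b.+1 else 0.

Definition turing_below (T : set (seq bool)) (z : nat -> bool) : Prop :=
  exists c : program, forall s : seq bool,
    (T s -> runs z c (strcode s) 1) /\ (~ T s -> runs z c (strcode s) 0).

(* [M p s] means that the machine M halts on input p with output s. *)
Definition partial_computable (M : seq bool -> seq bool -> Prop) : Prop :=
  exists c : program, forall p s, M p s <-> computes c (strcode p) (strcode s).

Definition prefix_free_machine (M : seq bool -> seq bool -> Prop) : Prop :=
  partial_computable M /\
  forall p q s t, M p s -> M q t -> prefix p q -> p = q.

Local Open Scope ring_scope.
Local Open Scope ereal_scope.

(* The infimum of the empty set is +oo: no description. *)
Definition complexity (R : realType) (M : seq bool -> seq bool -> Prop)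
    (s : seq bool) : \bar R :=
  ereal_inf [set (size p)%:R%:E | p in [set p | M p s]].

(* The universal machines defining prefix-free Kolmogorov complexity: [U] is  *)
(* such that K := complexity R U is minimal up to an additive constant.       *)
Definition optimal_machine (R : realType)
    (U : seq bool -> seq bool -> Prop) : Prop :=
  prefix_free_machine U /\
  forall M, prefix_free_machine M ->
    exists d : nat, forall s, complexity R U s <= complexity R M s + d%:R%:E.

Definition deficiency (R : realType) (U : seq bool -> seq bool -> Prop)
    (E : set (seq bool)) : \bar R :=
  ereal_sup [set (size s)%:R%:E - complexity R U s | s in E].

Definition cylinder (s : seq bool) : set (nat -> bool) :=
  [set x | mkseq x (size s) = s].

Definition generated_open (W : set (seq bool)) : set (nat -> bool) :=
  \bigcup_(s in W) cylinder s.

(* The outer measure generated by assigning 2^-|s| to the cylinder of s; on   *)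
(* Borel sets, in particular on open sets, it is the uniform (fair-coin)      *)
(* measure of Cantor space.                                                   *)
Definition uniform_measure (R : realType) (X : set (nat -> bool)) : \bar R :=
  ereal_inf [set \sum_(0 <= k <oo) (2 ^- size (c k))%:E
            | c in [set c : nat -> seq bool | X `<=` \bigcup_k cylinder (c k)]].

Definition uniformly_ce (W : nat -> set (seq bool)) : Prop :=
  exists c : program, forall n s,
    W n s <-> exists y, computes c (cpair n (strcode s)) y.

Definition ml_test (R : realType) (W : nat -> set (seq bool)) : Prop :=
  uniformly_ce W /\
  forall n, uniform_measure R (generated_open (W n)) <= (2 ^- n)%:E.

Definition ml_random (R : realType) (z : nat -> bool) : Prop :=
  forall W, ml_test R W -> ~ (\bigcap_n generated_open (W n)) z.

Definition is_tree (T : set (seq bool)) : Prop :=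
  T !=set0 /\ forall s t, prefix s t -> T t -> T s.

Definition strict_extension (s t : seq bool) : Prop := prefix s t /\ s <> t.

Definition perfect_tree (T : set (seq bool)) : Prop :=
  is_tree T /\
  forall s, T s -> exists t u,
    [/\ T t, T u, strict_extension s t, strict_extension s u &
        ~~ prefix t u /\ ~~ prefix u t].

Definition level (T : set (seq bool)) (n : nat) : set (seq bool) :=
  T `&` [set s | size s = n].

Definition weakly_incompressible (R : realType)
    (U : seq bool -> seq bool -> Prop) (T : set (seq bool)) : Prop :=
  limn_einf (fun n => deficiency R U (level T n)) < +oo.

(* Main.v *)
(* The tree of [z] consists of all strings that agree with [z] off the        *)
(* positions 4^e. Call [z] bad at [j] if every length m in the block          *)
(* (4^j, 4^(j+1)] carries a string of the tree with a description shorter     *)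
(* than m. Trading the first m bits of a string of length 4^(j+1) for the     *)
(* description of a compressible perturbation of them, plus their j+1 bits at *)
(* the free positions, is injective jointly in the string and in m, since the *)
(* machine is prefix-free. The block has 3 * 4^j lengths, so the [z] bad at   *)
(* [j] have measure at most 2^(j+1) / (3 * 4^j) <= 2^-j; moreover they form   *)
(* uniformly c.e. open sets. If the deficiency of the levels tended to        *)
(* infinity, [z] would be bad at all large [j], and so would fail a shift of  *)
(* this Martin-Loef test.                                                     *)
From Stdlib Require Cantor.
Require Import Defs.
From mathcomp Require Import all_boot all_order all_algebra.
From mathcomp Require Import zify lra.
From mathcomp Require Import all_classical all_reals all_analysis.

Set Implicit Arguments.
Unset Strict Implicit.
Unset Printing Implicit Defensive.

Import Order.TTheory GRing.Theory Num.Theory.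

(** * Computable functions *)

(** The bits at the sparse positions 4^e are freed and all others are copied from [z]. Infinitely
    many free positions make the tree perfect, membership is decided by comparing bits with [z], and
    a string of length at most 4^(j+1) has at most j+1 free positions, so moving inside the tree
    costs only logarithmically many bits.

    If the deficiency of the levels tended to infinity, then from some length on every level would
    contain a string with a description shorter than itself. For a single length this is no rare
    event, but for all 3 * 4^j lengths of a block at once it is: each bad string of length 4^(j+1)
    yields one short code per length, and these codes are all distinct, which is the counting bound
    [leq_card_bad]. Hence badness at j has measure at most 2^-j. It is also enumerable
    ([uniformly_ce_bad]), so it gives a Martin-Loef test ([ml_test_bad]) that [z] would fail.

    The enumerability is proved from scratch: [step] is a clocked evaluator, itself computable, and
    [computable_search] turns a computable condition on a stage into the domain of a program. *)

Definition cfst x := (Cantor.of_nat x).1.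
Definition csnd x := (Cantor.of_nat x).2.

Lemma cfst_pair x y : cfst (cpair x y) = x.
Proof. by rewrite /cfst Cantor.cancel_of_to. Qed.

Lemma csnd_pair x y : csnd (cpair x y) = y.
Proof. by rewrite /csnd Cantor.cancel_of_to. Qed.

Lemma cpairK x : cpair (cfst x) (csnd x) = x.
Proof. by rewrite /cfst /csnd -surjective_pairing Cantor.cancel_to_of. Qed.

Definition cpairE := (cfst_pair, csnd_pair).

(** Gives finitely many halting computations one common time bound: the tests that precede a
    successful [Mu], or the descriptions for all lengths of a block. *)
Lemma bounded_fuel (P : nat -> nat -> Prop) n :
    (forall i t t', t <= t' -> P i t -> P i t') ->
    (forall i, i < n -> exists t, P i t) ->
  exists t, forall i, i < n -> P i t.
Proof.
move=> Pmono; elim: n => [|n IHn] Pn; first by exists 0.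
have [i lt_in|t Pt] := IHn; first exact/Pn/ltnW.
have [t' Pt'] := Pn n (ltnSn n).
exists (maxn t t') => i; rewrite ltnS leq_eqVlt => /predU1P[->|/Pt].
  exact: Pmono (leq_maxr _ _) Pt'.
exact: Pmono (leq_maxl _ _).
Qed.

Section Computability.
Variable A : nat -> bool.

Definition computable (f : nat -> nat) :=
  exists c, forall x, runs A c x (f x).

Lemma computable_ext f g : f =1 g -> computable g -> computable f.
Proof. by move=> fg [c Hc]; exists c => x; rewrite fg. Qed.

Lemma computable_comp f g :
  computable f -> computable g -> computable (fun x => f (g x)).
Proof.
by move=> [c Hc] [d Hd]; exists (Comp c d) => x; apply: runs_comp (Hd x) (Hc _).
Qed.

Lemma computable_pair f g :
  computable f -> computable g -> computable (fun x => cpair (f x) (g x)).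
Proof.
by move=> [c Hc] [d Hd]; exists (Pair c d) => x; apply: runs_pair (Hc x) (Hd x).
Qed.

Lemma computable_cfst f : computable f -> computable (fun x => cfst (f x)).
Proof.
apply: computable_comp; exists Fst => x.
by rewrite -{1}(cpairK x); apply: runs_fst.
Qed.

Lemma computable_csnd f : computable f -> computable (fun x => csnd (f x)).
Proof.
apply: computable_comp; exists Snd => x.
by rewrite -{1}(cpairK x); apply: runs_snd.
Qed.

Lemma computable_id : computable (fun x => x).
Proof.
exists (Pair Fst Snd) => x; rewrite -(cpairK x).
by apply: runs_pair; [apply: runs_fst | apply: runs_snd].
Qed.

Lemma computable_succ f : computable f -> computable (fun x => (f x).+1).
Proof. by apply: computable_comp; exists Succ => x; apply: runs_succ. Qed.

Lemma computable_oracle f : computable f -> computable (fun x => A (f x)).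
Proof.
by apply: (@computable_comp A); exists Oracle => x; apply: runs_oracle.
Qed.

Lemma computable_const n : computable (fun=> n).
Proof.
elim: n => [|n IHn]; last exact: computable_succ.
by exists Zero => x; apply: runs_zero.
Qed.

Definition computable2 (f : nat -> nat -> nat) :=
  computable (fun w => f (cfst w) (csnd w)).

Lemma computable_comp2 f g h : computable2 f -> computable g -> computable h ->
  computable (fun x => f (g x) (h x)).
Proof.
move=> Hf Hg Hh; apply: computable_ext (computable_comp Hf (computable_pair Hg Hh)).
by move=> x; rewrite !cpairE.
Qed.

Lemma computable_rec (g b : nat -> nat) (h : nat -> nat -> nat -> nat) :
    computable g ->
    computable (fun w => h (cfst w) (cfst (csnd w)) (csnd (csnd w))) ->
    computable b ->
  computable (fun x => nat_rect (fun=> nat) (g x) (h x) (b x)).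
Proof.
move=> [c Hc] [d Hd]; apply: (@computable_comp2 (fun x n =>
  nat_rect (fun=> nat) (g x) (h x) n)) computable_id; exists (Rec c d) => w.
rewrite -{1}(cpairK w); elim: (csnd w) => [|n IHn] /=; first exact: runs_rec0.
apply: runs_recS IHn _.
by have := Hd (cpair (cfst w) (cpair n (nat_rect (fun=> nat) (g (cfst w))
  (h (cfst w)) n))); rewrite !cpairE.
Qed.

Lemma computable_if (b : nat -> bool) f g :
    computable b -> computable f -> computable g ->
  computable (fun x => if b x then f x else g x).
Proof.
move=> Hb Hf Hg; apply: (@computable_ext _ (fun x =>
  nat_rect (fun=> nat) (g x) (fun _ _ => f x) (b x))) => [x|].
  by case: (b x).
apply: computable_rec Hb => //.
exact: computable_comp Hf (computable_cfst computable_id).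
Qed.

Lemma computable_pred f : computable f -> computable (fun x => (f x).-1).
Proof.
move=> Hf; apply: (@computable_ext _ (fun x =>
  nat_rect (fun=> nat) 0 (fun n _ => n) (f x))) => [x|]; first by case: (f x).
apply: computable_rec Hf; first exact: computable_const.
exact/computable_cfst/computable_csnd/computable_id.
Qed.

Lemma computable_add f g :
  computable f -> computable g -> computable (fun x => f x + g x).
Proof.
move=> Hf Hg; apply: (@computable_ext _ (fun x =>
  nat_rect (fun=> nat) (g x) (fun _ r => r.+1) (f x))) => [x|].
  by elim: (f x) => //= n <-.
apply: computable_rec => //.
exact/computable_succ/computable_csnd/computable_csnd/computable_id.
Qed.

Lemma computable_sub f g :
  computable f -> computable g -> computable (fun x => f x - g x).
Proof.
move=> Hf Hg; apply: (@computable_ext _ (fun x =>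
  nat_rect (fun=> nat) (f x) (fun _ r => r.-1) (g x))) => [x|].
  by elim: (g x) => [|n IHn] /=; rewrite ?subn0 // subnS IHn.
apply: computable_rec => //.
exact/computable_pred/computable_csnd/computable_csnd/computable_id.
Qed.

Lemma computable_not (b : nat -> bool) :
  computable b -> computable (fun x => ~~ b x).
Proof.
move=> Hb; apply: (@computable_ext _ (fun x => if b x then 0 else 1)) => [x|].
  by case: (b x).
by apply: computable_if => //; apply: computable_const.
Qed.

Lemma computable_and (b c : nat -> bool) :
  computable b -> computable c -> computable (fun x => b x && c x).
Proof.
move=> Hb Hc; apply: (@computable_ext _ (fun x => if b x then c x : nat else 0)).
  by move=> x; case: (b x).
by apply: computable_if => //; apply: computable_const.
Qed.

Lemma computable_or (b c : nat -> bool) :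
  computable b -> computable c -> computable (fun x => b x || c x).
Proof.
move=> Hb Hc; apply: (@computable_ext _ (fun x => if b x then 1 else c x : nat)).
  by move=> x; case: (b x).
by apply: computable_if => //; apply: computable_const.
Qed.

Lemma computable_leq f g :
  computable f -> computable g -> computable (fun x => f x <= g x).
Proof.
move=> Hf Hg; apply: (@computable_ext _ (fun x => 1 - (f x - g x))) => [x|].
  by rewrite /leq; case: (f x - g x).
exact/computable_sub/computable_sub/Hg/Hf/computable_const.
Qed.

Lemma computable_eq f g :
  computable f -> computable g -> computable (fun x => f x == g x).
Proof.
move=> Hf Hg; apply: (@computable_ext _ (fun x => (f x <= g x) && (g x <= f x))).
  by move=> x; rewrite eqn_leq.
by apply: computable_and; apply: computable_leq.
Qed.

Lemma computable_eqb (b c : nat -> bool) :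
  computable b -> computable c -> computable (fun x => b x == c x).
Proof.
move=> Hb Hc; apply: computable_ext (computable_eq Hb Hc) => x.
by case: (b x); case: (c x).
Qed.

Lemma computable_pow4 f : computable f -> computable (fun x => 4 ^ f x).
Proof.
move=> Hf; apply: (@computable_ext _ (fun x =>
  nat_rect (fun=> nat) 1 (fun _ r => (r + r) + (r + r)) (f x))) => [x|].
  by elim: (f x) => //= n <-; rewrite expnS; lia.
have Hr : computable (fun w => csnd (csnd w)).
  exact/computable_csnd/computable_csnd/computable_id.
apply: computable_rec Hf; first exact: computable_const.
by do 2!apply: computable_add => //.
Qed.

Lemma computable_odd f : computable f -> computable (fun x => odd (f x)).
Proof.
move=> Hf; apply: (@computable_ext _ (fun x =>
  nat_rect (fun=> nat) 0 (fun _ r => 1 - r) (f x))) => [x|].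
  by elim: (f x) => //= n <-; case: (odd n).
apply: computable_rec Hf; first exact: computable_const.
apply: computable_sub; first exact: computable_const.
exact/computable_csnd/computable_csnd/computable_id.
Qed.

Lemma computable_half f : computable f -> computable (fun x => (f x)./2).
Proof.
move=> Hf; apply: (@computable_ext _ (fun x =>
  nat_rect (fun=> nat) 0 (fun n r => odd n + r) (f x))) => [x|].
  by elim: (f x) => // n IHn; rewrite /= -IHn uphalf_half.
apply: computable_rec Hf; first exact: computable_const.
apply: computable_add; first apply: computable_odd.
  exact/computable_cfst/computable_csnd/computable_id.
exact/computable_csnd/computable_csnd/computable_id.
Qed.

(** The accumulator equals the current index exactly as long as nothing has been found, so bounded
    search is primitive recursive. *)
Lemma find_iota_rec (a : pred nat) n : find a (iota 0 n) =
  nat_rect (fun=> nat) 0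
    (fun i r => if r == i then (if a i then i else i.+1) else r) n.
Proof.
elim: n => // n IHn; rewrite -[n.+1 in LHS]addn1 iotaD find_cat size_iota /= -IHn.
have := find_size a (iota 0 n); rewrite has_find size_iota leq_eqVlt.
case/predU1P=> [->|lt]; last by rewrite lt ltn_eqF.
by rewrite ltnn eqxx; case: (a n); rewrite ?addn0 ?addn1.
Qed.

Lemma computable_find (a : nat -> pred nat) b :
    computable (fun w => a (cfst w) (csnd w)) -> computable b ->
  computable (fun x => find (a x) (iota 0 (b x))).
Proof.
move=> Ha Hb; apply: computable_ext => [x|]; first exact: find_iota_rec.
have Hw := computable_id; have Hx := computable_cfst Hw.
have Hi := computable_cfst (computable_csnd Hw).
have Hr := computable_csnd (computable_csnd Hw).
apply: (@computable_rec _ _ (fun x i r =>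
  if r == i then if a x i then i else i.+1 else r)) Hb.
  exact: computable_const.
apply: computable_if => //; first exact: computable_eq.
apply: computable_if => //; last exact: computable_succ.
exact: (@computable_comp2 a).
Qed.

Lemma computable_has (a : nat -> pred nat) b :
    computable (fun w => a (cfst w) (csnd w)) -> computable b ->
  computable (fun x => has (a x) (iota 0 (b x))).
Proof.
move=> Ha Hb; apply: (@computable_ext _ (fun x =>
  (find (a x) (iota 0 (b x))).+1 <= b x)) => [x|].
  by rewrite has_find size_iota.
by apply: computable_leq => //; apply/computable_succ/computable_find.
Qed.

Lemma computable_all (a : nat -> pred nat) b :
    computable (fun w => a (cfst w) (csnd w)) -> computable b ->
  computable (fun x => all (a x) (iota 0 (b x))).
Proof.
move=> Ha Hb; apply: (@computable_ext _ (fun x =>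
  ~~ has (predC (a x)) (iota 0 (b x)))) => [x|].
  by rewrite has_predC negbK.
by apply/computable_not/computable_has => //; apply: computable_not.
Qed.

(* [step c x t] is [y.+1] if [c] halts on [x] with output [y] when every      *)
(* unbounded search is cut off at [t], and [0] if this cut prevents halting.  *)
Fixpoint step (c : program) (x t : nat) : nat :=
  match c with
  | Zero => 1
  | Succ => x.+2
  | Fst => (cfst x).+1
  | Snd => (csnd x).+1
  | Oracle => (A x).+1
  | Pair c d => if (step c x t == 0) || (step d x t == 0) then 0
                else (cpair (step c x t).-1 (step d x t).-1).+1
  | Comp c d => if step d x t == 0 then 0 else step c (step d x t).-1 t
  | Rec c d => nat_rect (fun=> nat) (step c (cfst x) t)
      (fun n r => if r == 0 then 0
                  else step d (cpair (cfst x) (cpair n r.-1)) t) (csnd x)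
  | Mu c => let i := find (fun i => step c (cpair x i) t <= 1) (iota 0 t) in
            if (i.+1 <= t) && (step c (cpair x i) t == 1) then i.+1 else 0
  end.

(** The induction is on [c] outside the model: each fixed program has its own clocked evaluator, so
    programs never have to be coded as numbers. *)
Lemma computable_step c f g :
  computable f -> computable g -> computable (fun x => step c (f x) (g x)).
Proof.
have Hw := computable_id; have Hx := computable_cfst Hw.
have Hy := computable_csnd Hw; have H0 := computable_const 0.
apply: computable_comp2; rewrite /computable2.
elim: c => [||||| c IHc d IHd | c IHc d IHd | c IHc d IHd | c IHc] /=.
- exact: computable_const.
- exact/computable_succ/computable_succ.
- exact/computable_succ/computable_cfst.
- exact/computable_succ/computable_csnd.
- exact/computable_succ/computable_oracle.
- apply: computable_if => //.
    by apply: computable_or; apply: computable_eq.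
  by apply/computable_succ/computable_pair; apply: computable_pred.
- apply: computable_if => //; first exact: computable_eq.
  by apply: (@computable_comp2 (step c)) => //; apply: computable_pred.
- apply: (@computable_rec (fun w => step c (cfst (cfst w)) (csnd w))
    (fun w => csnd (cfst w)) (fun w n r => if r == 0 then 0
      else step d (cpair (cfst (cfst w)) (cpair n r.-1)) (csnd w))).
  + by apply: (@computable_comp2 (step c)) => //; do !apply: computable_cfst.
  + have Hr : computable (fun w => csnd (csnd w)) by exact: computable_csnd.
    apply: computable_if => //; first exact: computable_eq.
    apply: (@computable_comp2 (step d)) => //; last exact: computable_csnd.
    apply: computable_pair; first exact/computable_cfst/computable_cfst.
    by apply: computable_pair; [apply: computable_cfst | apply: computable_pred].
  + exact: computable_csnd.
- set h := fun w i => step c (cpair (cfst w) i) (csnd w).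
  have Hh : computable2 h.
    apply: (@computable_comp2 (step c)) => //; last exact: computable_csnd.
    by apply: computable_pair => //; apply: computable_cfst.
  have Hi : computable (fun w => find (fun i => h w i <= 1) (iota 0 (csnd w))).
    apply: (@computable_find (fun w i => h w i <= 1)) => //.
    by apply: computable_leq => //; apply: computable_const.
  apply: computable_if => //; last exact: computable_succ.
  apply: computable_and; first by apply: computable_leq => //; apply: computable_succ.
  apply: computable_eq; last exact: computable_const.
  exact: (@computable_comp2 h).
Qed.

(** The bounded search stops at the first index where [step] is at most 1, that is, where [c] is cut
    off or outputs 0; only the second case is a success. *)
Lemma step_Mu c x t n : step (Mu c) x t = n.+1 <->
  [/\ n < t, step c (cpair x n) t = 1 &
      forall i, i < n -> 1 < step c (cpair x i) t].
Proof.
rewrite /=; set a := fun i => _; split.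
  case: ifP => // /andP[ltit /eqP stepi] [<-]; split=> // i lti.
  have := before_find 0 lti; rewrite nth_iota ?add0n; last exact: ltn_trans ltit.
  by rewrite /a leqNgt => /negbFE.
case=> ltnt stepn before; suff -> : find a (iota 0 t) = n by rewrite ltnt stepn.
case: (ltngtP (find a (iota 0 t)) n) => // [lt|gt].
  have lt_t := ltn_trans lt ltnt.
  have /(nth_find 0) : has a (iota 0 t) by rewrite has_find size_iota.
  by rewrite nth_iota // add0n /a leqNgt before.
by have := before_find 0 gt; rewrite nth_iota // add0n /a stepn.
Qed.

Lemma step_mono c x t t' y : t <= t' -> step c x t = y.+1 -> step c x t' = y.+1.
Proof.
move=> le_tt'.
elim: c x y => [||||| c IHc d IHd | c IHc d IHd | c IHc d IHd | c IHc] x y //.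
- rewrite /=; case Ec: (step c x t) => [|u] //; case Ed: (step d x t) => [|v] //.
  by rewrite (IHc _ _ Ec) (IHd _ _ Ed).
- by rewrite /=; case Ed: (step d x t) => [|v] //=; rewrite (IHd _ _ Ed); apply: IHc.
- rewrite /=; elim: (csnd x) y => [|n IHn] y /=; first exact: IHc.
  by case: (nat_rect _ _ _ n) IHn => [|u] // /(_ _ erefl) -> /=; apply: IHd.
- rewrite !step_Mu => -[ltyt stepy before]; split; first exact: leq_trans le_tt'.
    exact: IHc.
  move=> i /before; case Ei: (step _ _ t) => [|u] //.
  by rewrite (IHc _ _ Ei).
Qed.

Lemma step_runs c x t y : step c x t = y.+1 -> runs A c x y.
Proof.
elim: c x y => [||||| c IHc d IHd | c IHc d IHd | c IHc d IHd | c IHc] x y.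
- by case=> <-; apply: runs_zero.
- by case=> <-; apply: runs_succ.
- by case=> <-; rewrite -{1}(cpairK x); apply: runs_fst.
- by case=> <-; rewrite -{1}(cpairK x); apply: runs_snd.
- by case=> <-; apply: runs_oracle.
- rewrite /=; case Ec: (step c x t) => [|u] //; case Ed: (step d x t) => [|v] //.
  by case=> <-; apply: runs_pair (IHc _ _ Ec) (IHd _ _ Ed).
- rewrite /=; case Ed: (step d x t) => [|v] //= Ec.
  exact: runs_comp (IHd _ _ Ed) (IHc _ _ Ec).
- rewrite -(cpairK x) /= !cpairE.
  elim: (csnd x) y => [|n IHn] y /=; first by move/IHc/runs_rec0.
  case: (nat_rect _ _ _ n) IHn => [|u] // /(_ _ erefl) runsn /= /IHd.
  exact: runs_recS.
- rewrite step_Mu => -[_ /IHc runsy before].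
  apply: (@runs_mu A c x y (fun i => (step c (cpair x i) t).-2)) => // i /before lt1.
  by apply: IHc; case: (step _ _ _) lt1 => [|[]].
Qed.

Lemma step_Rec c d x n t : step (Rec c d) (cpair x n) t =
  nat_rect (fun=> nat) (step c x t)
    (fun n r => if r == 0 then 0 else step d (cpair x (cpair n r.-1)) t) n.
Proof. by rewrite [LHS]/(nat_rect _ _ _ _) !cpairE. Qed.

Lemma runs_step c x y : runs A c x y -> exists t, step c x t = y.+1.
Proof.
elim=> {c x y}.
- by exists 0.
- by exists 0.
- by move=> x y; exists 0; rewrite /= cpairE.
- by move=> x y; exists 0; rewrite /= cpairE.
- by exists 0.
- move=> c d x y z _ [t Ht] _ [t' Ht']; exists (maxn t t') => /=.
  by rewrite (step_mono (leq_maxl _ _) Ht) (step_mono (leq_maxr _ _) Ht').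
- move=> c d x y z _ [t Ht] _ [t' Ht']; exists (maxn t t') => /=.
  by rewrite (step_mono (leq_maxl _ _) Ht) (step_mono (leq_maxr _ _) Ht').
- by move=> c d x y _ [t Ht]; exists t; rewrite step_Rec.
- move=> c d x n y w _ [t Ht] _ [t' Ht']; exists (maxn t t').
  have := step_mono (leq_maxl t t') Ht; rewrite !step_Rec [in X in _ -> X]/= => -> /=.
  exact: step_mono (leq_maxr _ _) Ht'.
- move=> c x n f _ [t Ht] _ IH.
  have [|t' Ht'] := bounded_fuel
    (P := fun i s => step c (cpair x i) s = (f i).+2) _ IH.
    by move=> i s s'; apply: step_mono.
  exists (maxn n.+1 (maxn t t')); apply/step_Mu; split; first exact: leq_maxl.
    by apply: step_mono Ht; rewrite leq_max leq_maxl orbT.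
  move=> i /Ht' /(@step_mono _ _ _ (maxn n.+1 (maxn t t'))) -> //.
  by rewrite leq_max leq_maxr orbT.
Qed.

Lemma runs_inj c x y y' : runs A c x y -> runs A c x y' -> y = y'.
Proof.
move=> /runs_step[t Ht] /runs_step[t' Ht'].
apply: succn_inj; rewrite -(step_mono (leq_maxl t t') Ht).
exact: step_mono (leq_maxr t t') Ht'.
Qed.

Lemma computable_search (Q : nat -> pred nat) :
    computable2 (fun x t => Q x t) ->
  exists c, forall x, (exists t, Q x t) <-> exists y, runs A c x y.
Proof.
(* [Mu] looks for a zero, hence the negation. *)
move=> /computable_not[c Hc]; exists (Mu c) => x.
have {}Hc y i : runs A c (cpair y i) (~~ Q y i).
  by have := Hc (cpair y i); rewrite cfst_pair csnd_pair.
split=> [exQ | [y]].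
  case: (ex_minnP exQ) => m Qm minm; exists m.
  apply: (@runs_mu A c x m (fun=> 0)) => [|i lti]; first by have := Hc x m; rewrite Qm.
  by have := Hc x i; case: (boolP (Q x i)) => // /minm; rewrite leqNgt lti.
move Ed: (Mu c) => d runsd; case: runsd Ed => // c' x' n f run0 _ [Ec].
exists n; rewrite -Ec in run0; have := runs_inj run0 (Hc _ _).
by case: (Q x' n).
Qed.

End Computability.

(** * Codes of strings *)

Lemma strcode_surj x : exists s, strcode s = x.
Proof.
have [n] := ubnP x; elim: n x => // n IHn [|x] lt_xn; first by exists [::].
have [|s Es] := IHn x./2; first by lia.
by exists (odd x :: s); rewrite /= Es; have := odd_double_half x; lia.
Qed.

Lemma size_strcode s : size s <= strcode s.
Proof. by elim: s => //= b s IHs; lia. Qed.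

(** In bijective base 2, deleting the first bit is [y.-1./2], which fixes the code 0 of the empty
    string; access to strings thus becomes arithmetic on codes. *)
Definition code_drop i x := iter i (fun y => y.-1./2) x.

Lemma code_dropE s i : code_drop i (strcode s) = strcode (drop i s).
Proof.
rewrite drop_behead /code_drop; elim: i => //= i ->.
by case: (iter i behead s) => //= b s'; case: b; lia.
Qed.

Definition code_nth x i := odd (code_drop i x).-1.

Lemma code_nthE s i : code_nth (strcode s) i = nth false s i.
Proof.
rewrite /code_nth code_dropE -[i in RHS]addn0 -nth_drop.
by case: (drop i s) => //= b s'; case: b; rewrite addnS /= oddD odd_double.
Qed.

(** The size never exceeds the code. If no index below [x] succeeds, [find] returns [x], which is
    then the size. *)
Definition code_size x := find (fun i => code_drop i x == 0) (iota 0 x).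

Lemma code_sizeE s : code_size (strcode s) = size s.
Proof.
have dropE i : (code_drop i (strcode s) == 0) = (size s <= i).
  rewrite code_dropE -subn_eq0 -size_drop.
  by case: (drop i s) => //= b s'; rewrite addnS.
rewrite /code_size (eq_find dropE) -(subnKC (size_strcode s)) iotaD find_cat.
rewrite size_iota; case: hasP => [[i]|_].
  by rewrite mem_iota add0n => /andP[_ lti] /leq_ltn_trans /(_ lti); rewrite ltnn.
by case: (_ - _) => [|m]; rewrite /= ?leqnn addn0.
Qed.

(** The search may stop below [i] because e < 4^e. *)
Definition free i := has (fun e => i == 4 ^ e) (iota 0 i).

Lemma freeP i : reflect (exists e, i = 4 ^ e) (free i).
Proof.
apply: (iffP hasP) => [[e _ /eqP]|[e ->]]; first by exists e.
by exists e; rewrite ?mem_iota //= ltn_expl.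
Qed.

Definition agree s f :=
  all (fun i => free i || (nth false s i == f i)) (iota 0 (size s)).

Lemma agreeP s f :
  reflect (forall i, i < size s -> ~~ free i -> nth false s i = f i) (agree s f).
Proof.
apply: (iffP allP) => [sf i lti|sf i].
  by have := sf i; rewrite mem_iota; case: (free i) => //= /(_ lti)/eqP.
rewrite mem_iota => /andP[_ lti]; have := sf i lti.
by case: (free i) => //= ->.
Qed.

Definition code_agree x (f : nat -> bool) :=
  all (fun i => free i || (code_nth x i == f i)) (iota 0 (code_size x)).

Lemma code_agreeE s f : code_agree (strcode s) f = agree s f.
Proof. by rewrite /code_agree code_sizeE; apply: eq_all => i; rewrite code_nthE. Qed.

(** * Computability of the string operations on codes *)

Section ComputableStrings.
Variable A : nat -> bool.
Local Notation computable := (computable A).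

Lemma computable_code_drop f g : computable f -> computable g ->
  computable (fun x => code_drop (f x) (g x)).
Proof.
move=> Hf Hg; apply: (@computable_ext _ _ (fun x =>
  nat_rect (fun=> nat) (g x) (fun _ r => r.-1./2) (f x))) => [x|].
  by rewrite /code_drop; elim: (f x) => //= n ->.
apply: computable_rec => //; apply/computable_half/computable_pred.
exact/computable_csnd/computable_csnd/computable_id.
Qed.

Lemma computable_code_nth f g : computable f -> computable g ->
  computable (fun x => code_nth (f x) (g x)).
Proof. by move=> Hf Hg; apply/computable_odd/computable_pred/computable_code_drop. Qed.

Lemma computable_code_size f : computable f -> computable (fun x => code_size (f x)).
Proof.
move=> Hf; apply: computable_find => //; apply: computable_eq.
  apply: computable_code_drop; first exact/computable_csnd/computable_id.
  exact/(computable_comp Hf)/computable_cfst/computable_id.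
exact: computable_const.
Qed.

Lemma computable_free f : computable f -> computable (fun x => free (f x)).
Proof.
move=> Hf; apply: computable_has => //; apply: computable_eq.
  exact/(computable_comp Hf)/computable_cfst/computable_id.
exact/computable_pow4/computable_csnd/computable_id.
Qed.

Lemma computable_code_agree f (g : nat -> nat -> bool) :
    computable f -> computable (fun w => g (cfst w) (csnd w)) ->
  computable (fun x => code_agree (f x) (g x)).
Proof.
move=> Hf Hg; have Hi := computable_csnd (computable_id A).
have Hfx := computable_comp Hf (computable_cfst (computable_id A)).
apply: computable_all; last exact: computable_code_size.
apply: computable_or; first exact: computable_free.
by apply: computable_eqb => //; apply: computable_code_nth.
Qed.

End ComputableStrings.

Ltac computability := repeat lazymatch goal with
  | |- computable _ (fun x => x) => exact: computable_id
  | |- computable _ cfst => exact/computable_cfst/computable_id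
  | |- computable _ csnd => exact/computable_csnd/computable_id
  | |- computable _ (fun x => cfst _) => apply: computable_cfst
  | |- computable _ (fun x => csnd _) => apply: computable_csnd
  | |- computable _ (fun x => _.+1) => apply: computable_succ
  | |- computable _ (fun x => _.-1) => apply: computable_pred
  | |- computable _ (fun x => _ + _) => apply: computable_add
  | |- computable _ (fun x => _ - _) => apply: computable_sub
  | |- computable _ (fun x => 4 ^ _) => apply: computable_pow4
  | |- computable _ (fun x => nat_of_bool (_ && _)) => apply: computable_and
  | |- computable _ (fun x => nat_of_bool (_ <= _)) => apply: computable_leq
  | |- computable _ (fun x => nat_of_bool (_ == _)) => apply: computable_eq
  | |- computable _ (fun x => nat_of_bool (has _ _)) => apply: computable_has
  | |- computable _ (fun x => nat_of_bool (all _ _)) => apply: computable_all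
  | |- computable _ (fun x => nat_of_bool (code_agree _ _)) =>
      apply: computable_code_agree
  | |- computable _ (fun x => nat_of_bool (code_nth _ _)) => apply: computable_code_nth
  | |- computable _ (fun x => code_size _) => apply: computable_code_size
  | |- computable _ (fun x => step _ _ _ _) => apply: computable_step
  | |- computable _ (fun x => ?n) => exact: computable_const
  end.

(** * The tree and its bad levels *)

Definition perturbations (z : nat -> bool) : set (seq bool) := [set s | agree s z]%classic.

Lemma turing_below_perturbations z : turing_below (perturbations z) z.
Proof.
have [|c Hc] := @computable_code_agree z (fun x => x) (fun _ => z) (computable_id z).
  exact/computable_oracle/computable_csnd/computable_id.
exists c => s; have := Hc (strcode s); rewrite code_agreeE.
by split=> [sz|/negP/negbTE sz]; move: (Hc (strcode s)); rewrite code_agreeE sz.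
Qed.

Lemma is_tree_perturbations z : is_tree (perturbations z).
Proof.
split=> [|s t /prefixP[u ->] /agreeP tz]; first by exists [::].
apply/agreeP => i lti /tz <-; first by rewrite nth_cat lti.
by rewrite size_cat ltn_addr.
Qed.

Lemma perfect_tree_perturbations z : perfect_tree (perturbations z).
Proof.
split=> [|s /agreeP sz]; first exact: is_tree_perturbations.
(* Follow [z] from the end of [s] up to the free position 4^|s|, and branch there. *)
set n := 4 ^ size s; have lt_sn : size s < n by apply: ltn_expl.
pose ext b := mkseq (fun i => if i < size s then nth false s i
                              else if i == n then b else z i) n.+1.
have size_ext d : size (ext d) = n.+1 by rewrite size_mkseq.
have ext_in d : agree (ext d) z.
  apply/agreeP => i; rewrite size_ext => lti nfree; rewrite nth_mkseq //.
  case: ltnP => [/sz -> //|_]; case: eqP => // ein; case/freeP: nfree.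
  by exists (size s).
have ext_s d : strict_extension s (ext d).
  split; last by move=> Es; have := size_ext d; rewrite -Es; lia.
  rewrite prefixE -map_take take_iota (minn_idPl _) ?leqW ?(ltnW lt_sn) //.
  apply/eqP/(@eq_from_nth _ false) => [|i]; rewrite size_map size_iota // => lti.
  by rewrite (nth_map 0) ?size_iota // nth_iota // lti.
have ext_incomp d : ~~ prefix (ext d) (ext (~~ d)).
  rewrite prefixE take_oversize ?size_ext //; apply/eqP => /(congr1 (nth false ^~ n)).
  by rewrite !nth_mkseq // ltnNge (ltnW lt_sn) /= eqxx; case: d.
exists (ext true), (ext false); split=> //; exact: ext_in.
Qed.

(** * Counting the bad strings *)

Section Counting.
Variable U : seq bool -> seq bool -> Prop.

(** Badness of a real at j depends only on its first 4^(j+1) bits, so it is stated for strings of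
    exactly that length. The index [i] stands for the length m = 4^j + i + 1. *)
Definition bad j (r : seq bool) :=
  size r = 4 ^ j.+1 /\ forall i, i < 4 ^ j.+1 - 4 ^ j -> exists s p,
    [/\ U p s, size p < size s, size s = 4 ^ j + i.+1 & agree s (nth false r)].

Lemma prefix_total (s t r : seq bool) :
  prefix s r -> prefix t r -> prefix s t \/ prefix t s.
Proof.
rewrite !prefixE => /eqP sr /eqP tr; case: (leqP (size s) (size t)) => [le|/ltnW le].
  by left; rewrite -tr take_takel // sr.
by right; rewrite -sr take_takel // tr.
Qed.

Hypothesis U_fun : forall p s t, U p s -> U p t -> s = t.
Hypothesis U_prefix_free : forall p q s t, U p s -> U q t -> prefix p q -> p = q.

(** A pair of a bad string and a length in the block is encoded injectively by a word of length
    4^(j+1) and j+1 further bits. The length itself is not recorded: it is the size of the output of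
    the description. *)
Lemma leq_card_bad j :
  #|[pred r : (4 ^ j.+1).-tuple bool | `[< bad j r >]]| * (4 ^ j.+1 - 4 ^ j)
    <= 2 ^ (4 ^ j.+1) * 2 ^ j.+1.
Proof.
set N := 4 ^ j.+1; set B := N - 4 ^ j; set P := [pred r | _].
have le_jN : 4 ^ j <= N by rewrite leq_exp2l.
pose desc (x : N.-tuple bool * 'I_B) (y : seq bool * seq bool) :=
  [/\ U y.2 y.1, size y.2 < size y.1, size y.1 = 4 ^ j + x.2.+1 &
      agree y.1 (nth false x.1)].
have [|g gP] := @choice _ _ (fun x y => x.1 \in P -> desc x y).
  move=> [r i] /=; case: (boolP (r \in P)) => [Pr|_]; last by exists ([::], [::]).
  have /asboolP[_ /(_ i (ltn_ord i))[s [p desc_sp]]] : `[< bad j r >] := Pr.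
  by exists (s, p).
pose m (i : 'I_B) := 4 ^ j + i.+1.
have le_mN i : m i <= N by rewrite /m; have := ltn_ord i; rewrite /B; lia.
(* Replace the compressible perturbation of [r] by its description, and      *)
(* record separately the bits of [r] at the free positions.                  *)
pose w (x : N.-tuple bool * 'I_B) :=
  (g x).2 ++ nseq (m x.2 - size (g x).2) false ++ drop (m x.2) x.1.
pose F x := (insubd x.1 (w x) : N.-tuple bool,
  [tuple nth false (x.1 : seq bool) (4 ^ e) | e < j.+1]).
(* The description is shorter than m, so the zero padding restores length N and [insubd] never takes
   its default value. *)
have size_w x : x.1 \in P -> size (w x) = N.
  move/gP=> [_ lt_p Es _]; rewrite !size_cat size_nseq size_drop size_tuple.
  by have := le_mN x.2; move: lt_p; rewrite Es -/(m x.2); lia.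
have F_inj : {in [predX P & 'I_B] &, injective F}.
  move=> x y /andP[Px _] /andP[Py _] Exy.
  have Ew : w x = w y.
    by have := congr1 (fun u => val u.1) Exy; rewrite !insubdK //; apply/eqP/size_w.
  have [Ux ltx sizex agx] := gP _ Px; have [Uy lty sizey agy] := gP _ Py.
  (* Both descriptions are prefixes of the same word, hence comparable, hence equal by
     prefix-freeness. *)
  have Ep : (g x).2 = (g y).2.
    have [] := @prefix_total (g x).2 (g y).2 (w x); first exact: prefix_prefix.
    - by rewrite Ew; apply: prefix_prefix.
    - exact: U_prefix_free Ux Uy.
    - by move/(U_prefix_free Uy Ux).
  have Es : (g x).1 = (g y).1 by apply: U_fun Ux _; rewrite Ep.
  have Ei : x.2 = y.2.
    by apply/val_inj; move: sizey; rewrite -Es sizex => /addnI [].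
  have Em : m x.2 = size (g x).1 by rewrite sizex.
  have Edrop : drop (m x.2) x.1 = drop (m x.2) y.1.
    by move/eqP: Ew; rewrite /w -Ep -Ei !eqseq_cat // !eqxx => /eqP.
  suff Er : x.1 = y.1 by case: x y Er Ei {Px Py Ux Uy ltx lty sizex sizey agx agy
    Ew Exy Ep Es Em Edrop} => [r i] [r' i'] /= -> ->.
  apply/val_inj/(@eq_from_nth _ false) => [|k]; first by rewrite !size_tuple.
  rewrite size_tuple => ltkN; case: (leqP (m x.2) k) => [le_mk|lt_km].
    by rewrite -(subnKC le_mk) -!nth_drop Edrop.
  (* Below m, the bits off the free positions are read off the common output, and the free ones were
     recorded. *)
  case: (boolP (free k)) => [/freeP[e Ek]|nfree]; last first.
    move/agreeP: agx => <- //; last by rewrite -Em.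
    by move/agreeP: agy => <- //; rewrite -Es // -Em.
  have lt_ej : e < j.+1 by rewrite -(@ltn_exp2l 4) // -Ek.
  have := congr1 (fun u => tnth u.2 (Ordinal lt_ej)) Exy.
  by rewrite !tnth_mktuple /= Ek.
have := leq_card_in F _ F_inj; rewrite cardX card_ord card_prod !card_tuple card_bool.
by [].
Qed.

End Counting.

(** * Measure of a finite union of cylinders of equal length *)

Section Measure.
Variable R : realType.
Local Open Scope ring_scope.
Local Open Scope classical_set_scope.

Lemma uniform_measure_le (W : set (seq bool)) (l : seq (seq bool)) N n :
    (forall s, W s -> s \in l) -> {in l, forall s, size s = N} ->
    (size l * 2 ^ n.+1 <= 2 ^ N)%N ->
  (uniform_measure R (generated_open W) <= (2 ^- n)%:E)%E.
Proof.
move=> Wl size_l le_l.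
(* Covers are infinite sequences and no cylinder is empty, so the list is padded with strings of
   size k+n+2, of total weight at most 2^-(n+1). The list itself weighs at most as much, which is
   the reason for [n.+1] in the hypothesis. *)
pose c k := nth (nseq (k + n.+2) false) l k.
apply: ge_ereal_inf; exists (\sum_(0 <= k <oo) (2 ^- size (c k))%:E)%E.
  exists c => // x [s Ws xs]; have ls := Wl s Ws.
  by exists (index s l) => //; rewrite /c nth_index.
have size_c k : size (c k) = if (k < size l)%N then N else (k + n.+2)%N.
  rewrite /c; case: ltnP => [lt_k|le_k]; first exact/size_l/mem_nth.
  by rewrite nth_default // size_nseq.
pose h i : R := 2 ^- i.
have h_ge0 i : 0 <= h i by rewrite invr_ge0 exprn_ge0.
have hS i : h i = 2 * h i.+1.
  by rewrite /h exprS invfM mulrA divff ?mul1r // pnatr_eq0.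
(* The second summand is the telescoped padding weight of all k < K, including those where [l]
   supplies the string. *)
have le_partial K : \sum_(0 <= k < K) h (size (c k)) <=
    (minn K (size l))%:R * h N + (h n.+1 - h (K + n.+1)%N).
  elim: K => [|K IHK]; first by rewrite big_geq // min0n mul0r add0r add0n subrr.
  rewrite big_nat_recr //= size_c; apply: le_trans (lerD IHK (lexx _)) _.
  have := hS (K + n.+1)%N; have := h_ge0 (K + n.+2)%N; rewrite addSnnS -addnS.
  case: ltnP => [lt_K|le_K].
    have -> : minn K.+1 (size l) = K.+1 by lia.
    by rewrite -natr1 mulrDl mul1r; lra.
  have -> : minn K.+1 (size l) = size l by lia.
  lra.
apply: lime_le; first by apply: is_cvg_nneseries => k _ _; rewrite lee_fin h_ge0.
apply: nearW => K; rewrite sumEFin lee_fin; apply: le_trans (le_partial K) _.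
have lh : (minn K (size l))%:R * h N <= h n.+1.
  apply: (@le_trans _ _ ((size l)%:R * h N)).
    by apply: ler_wpM2r => //; rewrite ler_nat geq_minr.
  rewrite /h ler_pdivrMr ?exprn_gt0 // mulrC ler_pdivlMr ?exprn_gt0 //.
  by rewrite -!natrX -natrM ler_nat.
by have := h_ge0 (K + n.+1)%N; have := hS n; rewrite -/(h n); lra.
Qed.

End Measure.

(** * The test *)

Section BadTest.
Variables (R : realType) (U : seq bool -> seq bool -> Prop).
Hypothesis hU : prefix_free_machine U.

(** For each length, a short description is found by search; the quantifier over lengths is bounded,
    so a single stage can serve them all. *)
Lemma uniformly_ce_bad k : uniformly_ce (fun n => [set r | bad U (n + k) r]%classic).
Proof.
case: hU => -[cU UE] _; pose A : nat -> bool := fun=> false.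
(* A value 0 means no output by stage [t]; otherwise the output is the predecessor. *)
pose v p t := step A cU p t.
pose body j r t i p := [&& 0 < v p t, code_size p < code_size (v p t).-1,
  code_size (v p t).-1 == 4 ^ j + i.+1 & code_agree (v p t).-1 (code_nth r)].
(* The stage [t] bounds both the codes of the descriptions and the searches inside the run of
   [cU]. *)
pose Q x t := (code_size (csnd x) == 4 ^ (cfst x + k).+1) &&
  all (fun i => has (body (cfst x + k) (csnd x) t i) (iota 0 t))
      (iota 0 (4 ^ (cfst x + k).+1 - 4 ^ (cfst x + k))).
have HQ : computable2 A (fun x t => Q x t).
  rewrite /computable2 /Q /body /v; computability.
have [c Hc] := computable_search HQ.
exists c => n r; rewrite -Hc.
have QE t : Q (cpair n (strcode r)) t = (size r == 4 ^ (n + k).+1) &&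
    all (fun i => has (body (n + k) (strcode r) t i) (iota 0 t))
      (iota 0 (4 ^ (n + k).+1 - 4 ^ (n + k))).
  by rewrite /Q cfst_pair csnd_pair code_sizeE.
split=> [[size_r bad_r]|[t]]; last first.
  rewrite QE => /andP[/eqP size_r /allP Hr]; split=> // i lti.
  have /Hr/hasP[x _ /and4P[v_gt0]] : i \in iota 0 (4 ^ (n + k).+1 - 4 ^ (n + k)).
    by rewrite mem_iota.
  have [p Ep] := strcode_surj x; have [s Es] := strcode_surj (v x t).-1.
  rewrite -Es -Ep !code_sizeE code_agreeE => lt_p /eqP size_s /agreeP ag.
  exists s, p; split=> //.
    by apply/UE/(@step_runs _ _ _ t); rewrite Es Ep prednK.
  by apply/agreeP => l lt_l nfree; rewrite ag // code_nthE.
have [|i /bad_r[s [p [Ups lt_p size_s ag]]]|t Ht] := @bounded_fuel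
    (fun i t => has (body (n + k) (strcode r) t i) (iota 0 t)) (4 ^ (n + k).+1 - 4 ^ (n + k)).
- move=> i t t' le_tt' /hasP[p]; rewrite mem_iota => /andP[_ lt_p] /and4P[v_gt0 *].
  apply/hasP; exists p; first by rewrite mem_iota /= (leq_trans lt_p).
  have Ev : v p t' = v p t.
    by rewrite -(prednK v_gt0); apply: step_mono le_tt' _; rewrite prednK.
  by rewrite /body Ev; apply/and4P.
- have [t Ht] := runs_step ((UE p s).1 Ups).
  exists (maxn (strcode p).+1 t); apply/hasP; exists (strcode p).
    by rewrite mem_iota /= leq_maxl.
  have Ev : v (strcode p) (maxn (strcode p).+1 t) = (strcode s).+1.
    exact: step_mono (leq_maxr _ _) Ht.
  rewrite /body Ev !code_sizeE code_agreeE lt_p size_s eqxx /=.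
  by apply/agreeP => l lt_l nfree; rewrite code_nthE; apply: (agreeP _ _ ag).
- exists t; rewrite QE size_r eqxx; apply/allP => i; rewrite mem_iota => /andP[_].
  exact: Ht.
Qed.

Lemma machine_fun p s t : U p s -> U p t -> s = t.
Proof.
case: hU => -[cU UE] _ /UE Us /UE Ut.
have: strcode s = strcode t by apply: runs_inj Us Ut.
move=> Est; apply: (@eq_from_nth _ false) => [|i _].
  by rewrite -!code_sizeE Est.
by rewrite -!code_nthE Est.
Qed.

(** The shift by k lets the test start beyond any prescribed length; the extra 1 pays for the
    padding in [uniform_measure_le]. *)
Lemma ml_test_bad k : ml_test R (fun n => [set r | bad U (n + k.+1) r]%classic).
Proof.
split=> [|n]; first exact: uniformly_ce_bad.
set j := n + k.+1; set P := [pred r : (4 ^ j.+1).-tuple bool | `[< bad U j r >]].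
apply: (@uniform_measure_le R _ [seq val r | r <- enum P] (4 ^ j.+1)).
- move=> r bad_r; have size_r : size r == 4 ^ j.+1 by case: bad_r => ->.
  apply/mapP; exists (Tuple size_r) => //.
  by rewrite mem_enum; apply: asboolT.
- by move=> _ /mapP[r _ ->]; rewrite size_tuple.
- rewrite size_map -cardE.
  have le_card := leq_card_bad machine_fun hU.2 j.
  (* Since n+1 <= j, 2^(n+1) * 2^(j+1) <= 2 * 4^j, which is below the block size 3 * 4^j. *)
  rewrite -(@leq_pmul2r (2 ^ j.+1)) ?expn_gt0 //; apply: leq_trans le_card.
  rewrite -mulnA leq_mul2l; apply/orP; right.
  have lt_nj : 2 ^ n.+1 <= 2 ^ j by rewrite leq_exp2l // /j; lia.
  have E4 : 4 ^ j = 2 ^ j * 2 ^ j by rewrite -expnMn.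
  by rewrite [4 ^ j.+1]expnS E4 [2 ^ j.+1]expnS; move: (2 ^ n.+1) (2 ^ j) lt_nj; nia.
Qed.

End BadTest.

(** The limit inferior is the supremum of the tail infima, so some tail infimum is positive. The
    threshold 0 suits the application: positive deficiency yields a description shorter than its
    output. *)
Lemma limn_einf_pinfty (R : realType) (u : (\bar R)^nat) :
  ~ (limn_einf u < +oo)%E -> exists k, forall n, k <= n -> (0 < u n)%E.
Proof.
rewrite limn_einf_lim (cvg_lim _ (ereal_nondecreasing_cvgn (nondecreasing_einfs u))) //.
move=> /negP; rewrite -leNgt leye_eq => /eqP sup_oo.
have [|_ [k _ <-] inf_gt0] := @ereal_sup_gt R (range (einfs u)) 0%E.
  by rewrite sup_oo ltry.
exists k => n le_kn; apply: lt_le_trans inf_gt0 _; apply: ereal_inf_lbound.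
by exists n.
Qed.

Lemma deficiency_gt0 (R : realType) (U : seq bool -> seq bool -> Prop) E :
    (0 < deficiency R U E)%E ->
  exists s p, [/\ E s, U p s & size p < size s].
Proof.
case/ereal_sup_gt=> _ [s Es <-]; rewrite sube_gt0 => /ereal_inf_lt[_ [p Ups <-]].
by rewrite lte_fin ltr_nat => lt_ps; exists s, p.
Qed.

Theorem theorem1p4 (R : realType) (U : seq bool -> seq bool -> Prop)
    (hU : optimal_machine R U) (z : nat -> bool) (hz : ml_random R z) :
  exists T : set (seq bool),
    [/\ perfect_tree T, weakly_incompressible R U T & turing_below T z].
Proof.
exists (perturbations z); split; [exact: perfect_tree_perturbations| |
  exact: turing_below_perturbations].
apply: contrapT => /limn_einf_pinfty[k def_gt0].
apply: (hz _ (ml_test_bad R hU.1 k)) => n _.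
(* This initial segment of [z] is bad at j: all lengths of the block exceed 4^j > j > k, where every
   level has positive deficiency. *)
set j := n + k.+1; exists (mkseq z (4 ^ j.+1)); last by rewrite /cylinder /= size_mkseq.
split=> [|i lti]; first by rewrite size_mkseq.
have [|s [p [[/agreeP sz size_s] Ups lt_ps]]] :=
    deficiency_gt0 (def_gt0 (4 ^ j + i.+1) _).
  by have : j < 4 ^ j by [apply: ltn_expl]; rewrite /j; lia.
exists s, p; split=> //; apply/agreeP => l lt_l nfree.
by rewrite nth_mkseq ?sz //; move: lt_l; rewrite size_s; lia.
Qed.
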